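(* Let $n\ge 2$ and $G = V_{8n} = \langle x, y : x^{2n} = y^4 = 1,\ yx = x^{-1}y^{-1},\ y^{-1}x = x^{-1}y \rangle$. Then $E(\mathcal{CCC}(G)) \leq LE^+(\mathcal{CCC}(G)) \leq LE(\mathcal{CCC}(G))$, and in each of these two inequalities equality holds if and only if $n = 2$.
   Context: For a finite non-abelian group $G$, the commuting conjugacy class graph $\mathcal{CCC}(G)$ is the simple undirected graph whose vertices are the conjugacy classes of the non-central elements of $G$; two distinct vertices $x^G$ and $y^G$ are adjacent iff there exist $x'\in x^G$ and $y'\in y^G$ with $x'y'=y'x'$. For a finite graph $\mathcal{G}$ with adjacency matrix $A(\mathcal{G})$ and (diagonal) degree matrix $D(\mathcal{G})$, put $L(\mathcal{G})=D(\mathcal{G})-A(\mathcal{G})$ and $Q(\mathcal{G})=D(\mathcal{G})+A(\mathcal{G})$, and let $\mathrm{Spec}(\mathcal{G})$, $\mathrm{L\text{-}Spec}(\mathcal{G})$, $\mathrm{Q\text{-}Spec}(\mathcal{G})$ be the multisets of eigenvalues of $A(\mathcal{G})$, $L(\mathcal{G})$, $Q(\mathcal{G})$. With $d=\frac{2|e(\mathcal{G})|}{|V(\mathcal{G})|}$ ($|V(\mathcal{G})|$ the number of vertices, $|e(\mathcal{G})|$ the number of edges), the energy, Laplacian energy and signless Laplacian energy are $E(\mathcal{G})=\sum_{\lambda\in \mathrm{Spec}(\mathcal{G})}|\lambda|$, $LE(\mathcal{G})=\sum_{\mu\in \mathrm{L\text{-}Spec}(\mathcal{G})}|\mu-d|$,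 $LE^+(\mathcal{G})=\sum_{\nu\in \mathrm{Q\text{-}Spec}(\mathcal{G})}|\nu-d|$ (sums with multiplicity). *)

(* Defs.v *)
From mathcomp Require Import all_boot all_order all_algebra all_fingroup.
From mathcomp Require Import all_solvable all_field.

Set Implicit Arguments.
Unset Strict Implicit.
Unset Printing Implicit Defensive.

Import Order.TTheory GRing.Theory Num.Theory.

Record sgraph := SGraph {
  vertex :> finType;
  edge : rel vertex;
  edge_sym : symmetric edge;
  edge_irrefl : irreflexive edge }.

Section GraphSpectra.
Local Open Scope ring_scope.
Variable Gr : sgraph.

Definition edges : {set {set Gr}} :=
  [set [set p.1; p.2] | p in [pred p : Gr * Gr | edge p.1 p.2]].

Definition degree (v : Gr) : nat := #|[set w | edge v w]|.

Definition adj_mx : 'M[algC]_#|Gr| :=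
  \matrix_(i, j) (edge (enum_val i) (enum_val j))%:R.

Definition deg_mx : 'M[algC]_#|Gr| :=
  diag_mx (\row_i (degree (enum_val i))%:R).

Definition laplacian_mx : 'M[algC]_#|Gr| := deg_mx - adj_mx.
Definition signless_laplacian_mx : 'M[algC]_#|Gr| := deg_mx + adj_mx.

Definition avg_degree : algC := (2 * #|edges|)%:R / #|Gr|%:R.

End GraphSpectra.

Arguments edges : clear implicits.
Arguments adj_mx : clear implicits.
Arguments deg_mx : clear implicits.
Arguments laplacian_mx : clear implicits.
Arguments signless_laplacian_mx : clear implicits.
Arguments avg_degree : clear implicits.

(* The roots of the characteristic polynomial, repeated according to their
   algebraic multiplicity; only the order of this sequence is unspecified. *)
Definition spectrum (n : nat) (A : 'M[algC]_n) : seq algC :=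
  sval (closed_field_poly_normal (char_poly A)).

Section Energies.
Local Open Scope ring_scope.
Variable Gr : sgraph.

Definition energy : algC :=
  \sum_(l <- spectrum (adj_mx Gr)) `|l|.

Definition laplacian_energy : algC :=
  \sum_(m <- spectrum (laplacian_mx Gr)) `|m - avg_degree Gr|.

Definition signless_laplacian_energy : algC :=
  \sum_(v <- spectrum (signless_laplacian_mx Gr)) `|v - avg_degree Gr|.

End Energies.

Section CommutingConjugacyClassGraph.
Local Open Scope group_scope.
Variables (gT : finGroupType) (G : {group gT}).

Definition noncentral_classes : {set {set gT}} :=
  [set x ^: G | x in G :\: 'Z(G)].

Definition ccc_vertex := {C : {set gT} | C \in noncentral_classes}.

Definition ccc_edge : rel ccc_vertex := fun C D =>
  (C != D) && [exists x in val C, exists y in val D, x * y == y * x].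

Lemma ccc_edge_sym : symmetric ccc_edge.
Proof.
suff sub C D : ccc_edge C D -> ccc_edge D C by move=> C D; apply/idP/idP; apply: sub.
case/andP=> neqCD /exists_inP[x Cx /exists_inP[y Dy /eqP xy]].
rewrite /ccc_edge eq_sym neqCD; apply/exists_inP; exists y => //.
by apply/exists_inP; exists x => //; rewrite xy.
Qed.

Lemma ccc_edge_irrefl : irreflexive ccc_edge.
Proof. by move=> C; rewrite /ccc_edge eqxx. Qed.

Definition CCC : sgraph := SGraph ccc_edge_sym ccc_edge_irrefl.

End CommutingConjugacyClassGraph.

(* Main.v *)
(* Put z = y^2, which is central, and N = <x, z>, an abelian normal subgroup of
   index 2. Elements of N that are not central have classes of size 2, and
   distinct such classes are adjacent. If g is outside N, then its class is the
   coset g<k> with k = zx^2, and C_G(g) = Z(G) u gZ(G); hence the classes of g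
   and h (both outside N) are joined iff g^-1 h lies in M = <k>Z(G) = <x^2, z>.
   So CCC(G) is the disjoint union of three cliques, with 2n - w, w and w
   vertices, where w = gcd(2, n).

   For a disjoint union of cliques, the matrices A, L and Q all have the form
   diag(a_c(i)) + b J, where J is the block matrix of ones; a block determinant
   computation gives the characteristic polynomial, and thus the energies are
   explicit functions of the clique sizes. *)
Require Import Defs.
From mathcomp Require Import all_boot all_order all_algebra all_fingroup.
From mathcomp Require Import all_solvable all_field.
From mathcomp Require Import zify ring lra.

Set Implicit Arguments.
Unset Strict Implicit.
Unset Printing Implicit Defensive.

Import Order.TTheory GRing.Theory Num.Theory.

(** * Spectra of disjoint unions of cliques *)

Section ClusterSpectrum.
Local Open Scope ring_scope.

Lemma char_poly_spectrum n (A : 'M[algC]_n) :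
  char_poly A = \prod_(z <- spectrum A) ('X - z%:P).
Proof.
rewrite /spectrum; case: closed_field_poly_normal => r /= {1}->.
by rewrite (monicP (char_poly_monic A)) scale1r.
Qed.

(* The factor [\prod_j ('X - a j)] on the left replaces the exponents
   [#|c^-1(j)| - 1] on the right, and so allows empty classes. With [E] the
   incidence matrix of [c] and [D], [D'] the diagonal matrices of ['X - a (c i)]
   and ['X - a j], one has [E^T D = D' E^T], and [\det (D - b E E^T)] is the
   determinant of [block_mx D (b E) E^T 1]. *)
Lemma char_poly_cluster (F : idomainType) n k (c : 'I_n -> 'I_k) (a : 'I_k -> F) (b : F) :
  \prod_j ('X - (a j)%:P) *
    char_poly (\matrix_(i, j) (a (c i) *+ (i == j) + b *+ (c i == c j))) =
  \prod_i ('X - (a (c i))%:P) *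
    \prod_j ('X - (a j + b *+ #|[set i | c i == j]|)%:P).
Proof.
set A := \matrix_(i, j) _.
pose D : 'M[{poly F}]_n := diag_mx (\row_i ('X - (a (c i))%:P)).
pose D' : 'M[{poly F}]_k := diag_mx (\row_j ('X - (a j)%:P)).
pose E : 'M[{poly F}]_(n, k) := \matrix_(i, j) (c i == j)%:R.
have defA : char_poly_mx A = D - b%:P *: (E *m E^T).
  apply/matrixP=> i j; rewrite !mxE (bigD1 (c i)) //= big1 => [|l nl]; last first.
    by rewrite !mxE eq_sym (negPf nl) mul0r.
  rewrite !mxE eqxx mul1r addr0 rmorphD /= !rmorphMn /= opprD addrA -mulrnBl.
  by rewrite [c j == _]eq_sym mulr_natr.
have ED : E^T *m D = D' *m E^T.
  apply/matrixP=> i j; rewrite mul_mx_diag mul_diag_mx !mxE.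
  by case: eqP => [->|_]; rewrite ?mul0r ?mulr0 // mul1r mulr1.
have EE : D' - b%:P *: (E^T *m E) =
    diag_mx (\row_j ('X - (a j + b *+ #|[set i | c i == j]|)%:P)).
  apply/matrixP=> i j; rewrite !mxE.
  rewrite (eq_bigr (fun l => ((c l == i) && (i == j))%:R)); last first.
    move=> l _; rewrite !mxE -natrM mulnb; congr (_%:R).
    by case: eqP => //= ->.
  case: eqP => _; last by rewrite big1 ?mulr0 ?subr0 // => l _; rewrite andbF.
  rewrite mulr1n rmorphD /= opprD addrA; congr (_ - _).
  rewrite rmorphMn /= -mulr_natr -sum1_card natr_sum; congr (_ * _).
  rewrite [RHS]big_mkcond /=.
  by apply: eq_bigr => l _; rewrite andbT inE; case: eqP.
have det_row m (u : 'I_m -> {poly F}) : \det (diag_mx (\row_i u i)) = \prod_i u i.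
  by rewrite det_diag; apply: eq_bigr => i _; rewrite mxE.
pose B : 'M[{poly F}]_(n + k) := block_mx D (b%:P *: E) E^T 1%:M.
have detB : \det B = char_poly A.
  rewrite /char_poly defA.
  have -> : B = block_mx (D - b%:P *: (E *m E^T)) (b%:P *: E) 0 1%:M *m block_mx 1%:M 0 E^T 1%:M.
    rewrite mulmx_block !mulmx0 !mul0mx !mulmx1 !mul1mx !add0r.
    by rewrite -scalemxAl subrK.
  by rewrite det_mulmx det_ublock det_lblock !det1 !mulr1.
(* By [ED], the lower left block of this product is [D' *m E^T - E^T *m D = 0], so [D] is never
   inverted; the price is the factor [\det D']. *)
have : \det (block_mx 1%:M 0 (- E^T) D' *m B) =
    \det (block_mx D (b%:P *: E) 0 (D' - b%:P *: (E^T *m E))).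
  congr (\det _); rewrite mulmx_block !mul1mx !mul0mx !addr0 !mulmx1 !mulNmx ED addNr.
  by rewrite -scalemxAr addrC.
by rewrite EE det_mulmx det_lblock det_ublock det1 mul1r detB !det_row.
Qed.

(** Equal products of monic linear factors have the same roots up to order. On a class of size [m],
    [a j] is an eigenvalue [m - 1] times and [a j + b *+ m] once; written with a subtraction, the
    contribution of an empty class cancels to 0. *)
Lemma sum_spectrum_cluster n k (c : 'I_n -> 'I_k) (a : 'I_k -> algC) (b : algC)
    (f : algC -> algC) :
  \sum_(l <- spectrum (\matrix_(i, j) (a (c i) *+ (i == j) + b *+ (c i == c j)))) f l =
  \sum_j (f (a j) *+ #|[set i | c i == j]| - f (a j) + f (a j + b *+ #|[set i | c i == j]|)).
Proof.
have := char_poly_cluster c a b; rewrite char_poly_spectrum.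
set s := spectrum _; pose X (z : algC) := 'X - z%:P.
rewrite -(big_map a predT X) -(big_map (a \o c) predT X).
rewrite -(big_map (fun j => a j + b *+ #|[set i | c i == j]|) predT X).
rewrite -!big_cat => /prod_XsubC_eq roots_eq.
have := perm_big (op := +%R) (x := 0) _ roots_eq (P := predT) (F := f).
rewrite !big_cat !big_map /= => sum_eq.
apply: (addrI (\sum_j f (a j))); rewrite sum_eq.
rewrite (partition_big c predT) //= -!big_split /=; apply: eq_bigr => j _.
rewrite addrA subrKC; congr (_ + _).
rewrite (eq_bigr (fun=> f (a j))) => [|i /eqP-> //].
by rewrite sumr_const; congr (_ *+ _); apply: eq_card => i; rewrite !inE.
Qed.

(** Handshake by fibres: [ends] maps ordered adjacent pairs onto edges, and the fibre of an edge is
    [{(u, v), (v, u)}], two elements because there are no loops. *)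
Lemma double_card_edges (Gr : sgraph) : (2 * #|edges Gr| = \sum_(v : Gr) degree v)%N.
Proof.
pose P : {set Gr * Gr} := [set p | edge p.1 p.2].
pose ends (p : Gr * Gr) := [set p.1; p.2].
have -> : (\sum_(v : Gr) degree v = #|P|)%N.
  rewrite -sum1_card (eq_bigl (fun p => predT p.1 && edge p.1 p.2)); last first.
    by move=> p; rewrite inE.
  rewrite -(pair_big_dep predT (fun u v : Gr => edge u v) (fun _ _ => 1%N)) /=.
  by apply: eq_bigr => v _; rewrite /degree -sum1_card; apply: eq_bigl => w; rewrite inE.
have -> : edges Gr = ends @: P.
  apply/setP=> e; apply/imsetP/imsetP => -[p Pp ->]; exists p => //.
    by rewrite inE; move: Pp; rewrite inE.
  by move: Pp; rewrite !inE.
rewrite -[#|P|]sum1_card (partition_big_imset ends) /= -sum1_card big_distrr /=.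
apply: eq_bigr => _ /imsetP[[u v] Puv ->]; rewrite muln1.
have uv : edge u v by move: Puv; rewrite inE.
have nuv : u != v by apply: contraTneq uv => ->; rewrite edge_irrefl.
rewrite sum1_card -(_ : #|[set (u, v); (v, u)]| = 2)%N; last first.
  by rewrite cards2 xpair_eqE negb_and nuv.
apply: eq_card => -[u' v']; rewrite !inE /= !xpair_eqE.
apply/orP/andP => [[]/andP[/eqP-> /eqP->] | [uv' /eqP eq_ends]].
- by rewrite inE.
- by rewrite inE /= edge_sym uv /ends /= setUC.
have {}uv' : edge u' v' by rewrite inE in uv'.
have nuv' : u' != v' by apply: contraTneq uv' => ->; rewrite edge_irrefl.
have : u' \in ends (u, v) by rewrite -eq_ends !inE eqxx.
have : v' \in ends (u, v) by rewrite -eq_ends !inE eqxx orbT.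
rewrite !inE /= => /orP[]/eqP v'E /orP[]/eqP u'E; move: nuv'; rewrite u'E v'E eqxx //.
- by right; rewrite !eqxx.
- by left; rewrite !eqxx.
Qed.

(* Contribution of a clique with [t] vertices to the three energies of a
   disjoint union of cliques of average degree [d]. *)
Definition clique_energy (t : rat) := t - 1 + `|t - 1|.
Definition clique_signless_energy (d t : rat) :=
  (t - 1) * `|t - 2 - d| + `|2 * t - 2 - d|.
Definition clique_laplacian_energy (d t : rat) := (t - 1) * `|t - d| + `|d|.

Section ClusterGraph.
Variables (Gr : sgraph) (k : nat) (c : Gr -> 'I_k).
Hypothesis edge_cluster : forall u v, edge u v = (u != v) && (c u == c v).
Local Notation m j := #|[set u | c u == j]|.

Lemma degree_cluster v : degree v = (m (c v)).-1.
Proof.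
rewrite [in RHS](cardsD1 v) inE eqxx /=.
by apply: eq_card => w; rewrite !inE edge_cluster eq_sym [c w == _]eq_sym.
Qed.

Lemma natr_degree_cluster (R : pzRingType) v : (degree v)%:R = (m (c v))%:R - 1 :> R.
Proof.
rewrite degree_cluster; have : (0 < m (c v))%N.
  by apply/card_gt0P; exists v; rewrite inE.
by case: (m _) => // i _; rewrite -natr1 addrK.
Qed.

Lemma card_cluster_enum j : #|[set i : 'I_#|Gr| | c (enum_val i) == j]| = m j.
Proof.
rewrite -(card_imset _ enum_val_inj); apply: eq_card => u; rewrite inE.
apply/imsetP/idP => [[i cij ->] | cuj]; first by rewrite inE in cij.
by exists (enum_rank u); rewrite ?inE enum_rankK.
Qed.

(** Brings spectral sums down from [algC] to [rat], where the energies can be compared by ordered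
    field arithmetic. *)
Lemma sum_cluster_mx (A : 'M[algC]_#|Gr|) (a : 'I_k -> rat) (b : rat) (f : rat -> rat)
  (g : algC -> algC) :
    (forall u v, A (enum_rank u) (enum_rank v) =
       ratr (a (c u)) *+ (u == v) + ratr b *+ (c u == c v)) ->
    (forall x, ratr (f x) = g (ratr x)) ->
  \sum_(l <- spectrum A) g l =
  ratr (\sum_j ((m j)%:R * f (a j) - f (a j) + f (a j + b * (m j)%:R))).
Proof.
move=> defA fg.
have {defA} -> : A = \matrix_(i, j) (ratr (a (c (enum_val i))) *+ (i == j)
                                + ratr b *+ (c (enum_val i) == c (enum_val j))).
  apply/matrixP=> i j; rewrite mxE -{1}(enum_valK i) -{1}(enum_valK j) defA.
  by rewrite (inj_eq enum_val_inj).
rewrite (sum_spectrum_cluster (c \o enum_val) (fun j => ratr (a j))) /=.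
rewrite raddf_sum; apply: eq_bigr => j _; rewrite card_cluster_enum.
rewrite raddfD raddfB /= rmorphM /= !fg rmorphD rmorphM /= ratr_nat.
by rewrite mulr_natl mulr_natr.
Qed.

Definition cluster_avg_degree : rat :=
  (\sum_j (m j)%:R * ((m j)%:R - 1)) / \sum_j (m j)%:R.
Local Notation d := cluster_avg_degree.

Lemma avg_degree_cluster : avg_degree Gr = ratr d.
Proof.
rewrite /avg_degree double_card_edges natr_sum fmorph_div !raddf_sum /=; congr (_ / _).
  rewrite (partition_big c predT) //=; apply: eq_bigr => j _.
  rewrite (eq_bigr (fun=> (m j)%:R - 1)) => [|v /eqP<-]; last exact: natr_degree_cluster.
  rewrite sumr_const rmorphM rmorphB /= ratr_nat rmorph1 mulr_natl; congr (_ *+ _).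
  by apply: eq_card => v; rewrite !inE.
rewrite -sum1_card (partition_big c predT) //= natr_sum; apply: eq_bigr => j _.
by rewrite ratr_nat -sum1_card; congr (_%:R); apply: eq_bigl => v; rewrite inE.
Qed.

Lemma energy_cluster : energy Gr = ratr (\sum_j clique_energy (m j)%:R).
Proof.
(* On a clique with t vertices A = J - I, with eigenvalues -1 (t - 1 times) and t - 1. *)
rewrite /energy (sum_cluster_mx (a := fun=> -1) (b := 1) (f := Num.norm)).
- congr ratr; apply: eq_bigr => j _.
  by rewrite /clique_energy normrN1 mulr1 mul1r [-1 + _]addrC.
- move=> u v; rewrite mxE !enum_rankK edge_cluster rmorphN1 rmorph1.
  by case: eqP => [->|_] /=; rewrite ?eqxx ?addNr ?add0r.
- by move=> x; rewrite ratr_norm.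
Qed.

Lemma laplacian_energy_cluster :
  laplacian_energy Gr = ratr (\sum_j clique_laplacian_energy d (m j)%:R).
Proof.
rewrite /laplacian_energy avg_degree_cluster.
(* Here L = t I - J, with eigenvalues t (t - 1 times) and 0. *)
rewrite (sum_cluster_mx (a := fun j => (m j)%:R) (b := -1) (f := fun x => `|x - d|)).
- congr ratr; apply: eq_bigr => j _.
  by rewrite /clique_laplacian_energy mulrBl mul1r mulN1r subrr sub0r normrN.
- move=> u v; rewrite !mxE !enum_rankK edge_cluster natr_degree_cluster rmorphN1 ratr_nat.
  rewrite (inj_eq enum_rank_inj).
  by case: eqP => [->|_] /=; rewrite ?eqxx ?mulr0n ?mulr1n ?subr0 ?add0r ?mulNrn.
- by move=> x; rewrite ratr_norm rmorphB.
Qed.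

Lemma signless_laplacian_energy_cluster :
  signless_laplacian_energy Gr =
    ratr (\sum_j clique_signless_energy d (m j)%:R).
Proof.
rewrite /signless_laplacian_energy avg_degree_cluster.
(* Here Q = (t - 2) I + J, with eigenvalues t - 2 (t - 1 times) and 2t - 2. *)
rewrite (sum_cluster_mx (a := fun j => (m j)%:R - 2) (b := 1) (f := fun x => `|x - d|)).
- congr ratr; apply: eq_bigr => j _.
  by rewrite /clique_signless_energy mulrBl mul1r mul1r; congr (_ + `|_|); ring.
- move=> u v; rewrite !mxE !enum_rankK edge_cluster natr_degree_cluster rmorph1.
  rewrite rmorphB /= !ratr_nat (inj_eq enum_rank_inj).
  case: eqP => [->|_] /=; rewrite ?eqxx ?mulr0n ?mulr1n ?addr0 ?add0r //.
  ring.
- by move=> x; rewrite ratr_norm rmorphB.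
Qed.
End ClusterGraph.
End ClusterSpectrum.

(** * The order of the group *)

Section Model.
Variable n : nat.
Hypothesis n_gt0 : (0 < n)%N.
Local Notation T := ('Z_(2 * n) * 'Z_4)%type.
Local Open Scope ring_scope.

(* The right regular representation of V8n in suitable coordinates: [y^m x^i]
   maps [(0, 0)] to [(i, (-1)^i m)], so the action is transitive, which gives
   the lower bound 8n for the order. *)
Definition model_x_fun (p : T) : T := (p.1 + 1, - p.2).
Definition model_y_fun (p : T) : T := (- p.1, p.2 + 1).

Lemma model_x_inj : injective model_x_fun.
Proof. by move=> [a b] [c d] /pair_equal_spec /= [/addIr-> /oppr_inj->]. Qed.
Lemma model_y_inj : injective model_y_fun.
Proof. by move=> [a b] [c d] /pair_equal_spec /= [/oppr_inj-> /addIr->]. Qed.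

Definition model_x := perm model_x_inj.
Definition model_y := perm model_y_inj.

Lemma model_xV p : (model_x^-1)%g p = (p.1 - 1, - p.2).
Proof.
apply: (@perm_inj _ model_x); rewrite permKV permE /model_x_fun /=.
by rewrite subrK opprK; case: p.
Qed.

Lemma model_yV p : (model_y^-1)%g p = (- p.1, p.2 - 1).
Proof.
apply: (@perm_inj _ model_y); rewrite permKV permE /model_y_fun /=.
by rewrite subrK opprK; case: p.
Qed.

Lemma model_xX i p : (model_x ^+ i)%g p = (p.1 + i%:R, (-1) ^+ i * p.2).
Proof.
elim: i => [|i IHi]; first by rewrite perm1 addr0 expr0 mul1r; case: p.
by rewrite expgSr permM IHi permE /model_x_fun /= -addrA natr1 exprS mulN1r mulNr.
Qed.

Lemma model_yX i p : (model_y ^+ i)%g p = ((-1) ^+ i * p.1, p.2 + i%:R).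
Proof.
elim: i => [|i IHi]; first by rewrite perm1 addr0 expr0 mul1r; case: p.
by rewrite expgSr permM IHi permE /model_y_fun /= -addrA natr1 exprS mulN1r mulNr.
Qed.

Definition model : {group {perm T}} := (<[model_x]> <*> <[model_y]>)%G.

Lemma model_homGrp :
  (model \homg Grp (x : y : x ^+ (2 * n), y ^+ 4,
                        y * x = x^-1 * y^-1, y^-1 * x = x^-1 * y))%g.
Proof.
apply/existsP; exists (model_x, model_y); rewrite /= !xpair_eqE eqxx /=.
apply/and4P; split; apply/eqP/permP => -[a b].
- rewrite model_xX perm1 exprM sqrrN expr1n expr1n mul1r.
  have -> : (2 * n)%:R = 0 :> 'Z_(2 * n).
    by apply: val_inj; rewrite /= val_Zp_nat ?modnn; lia.
  by rewrite addr0.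
- by rewrite model_yX perm1 -signr_odd mul1r pchar_Zp ?addr0.
- rewrite !permM model_xV model_yV !permE /model_x_fun /model_y_fun /=.
  by rewrite opprB opprD addrC.
- rewrite !permM model_xV model_yV !permE /model_x_fun /model_y_fun /=.
  by rewrite !opprB addrC [1 - b]addrC.
Qed.

Lemma leq_card_model : (8 * n <= #|model|)%N.
Proof.
have -> : (8 * n = #|{: T}|)%N by rewrite card_prod !card_ord !Zp_cast //; lia.
pose f (s : {perm T}) := s (0, 0).
apply: leq_trans (leq_imset_card f model).
apply/subset_leq_card/subsetP => -[a b] _.
(* The sign anticipates that [model_x ^+ a] multiplies the second coordinate by [(-1) ^+ a]. *)
have [c ->] : exists c : 'Z_4, b = (-1) ^+ a * c.
  by exists ((-1) ^+ a * b); rewrite mulrA -expr2 sqrr_sign mul1r.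
apply/imsetP; exists (model_y ^+ c * model_x ^+ a)%g.
  by rewrite groupM // groupX // mem_gen // inE cycle_id ?orbT.
by rewrite /f permM model_yX model_xX /= mulr0 !add0r !natr_Zp.
Qed.
End Model.

(** * Conjugacy classes and commutation *)

Section Structure.
Local Open Scope group_scope.
Variables (gT : finGroupType) (G : {group gT}) (x y : gT) (n : nat).
Hypothesis n_gt0 : 0 < n.
Hypothesis defG : <[x]> <*> <[y]> = G.
Hypothesis x2n : x ^+ (2 * n) = 1.
Hypothesis y4 : y ^+ 4 = 1.
Hypothesis yx : y * x = x^-1 * y^-1.
Hypothesis yVx : y^-1 * x = x^-1 * y.
Hypothesis oG_ge : 8 * n <= #|G|.

Local Notation z := (y ^+ 2).
Local Notation k := (z * x ^+ 2).
Local Notation N := (<[x]> <*> <[z]>).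
Local Notation M := (<[x ^+ 2]> <*> <[z]>).
Local Notation Z := 'Z(G).

(** * Consequences of the relations; centrality of [z] *)

Lemma mem_x_G : x \in G. Proof. by rewrite -defG mem_gen // inE cycle_id. Qed.
Lemma mem_y_G : y \in G. Proof. by rewrite -defG mem_gen // inE cycle_id orbT. Qed.
Hint Resolve mem_x_G mem_y_G : core.

Lemma mul_zz : z * z = 1. Proof. by rewrite -expgD y4. Qed.
Lemma inv_z : z^-1 = z. Proof. by apply/eqP; rewrite eq_invg_mul mul_zz. Qed.

Lemma conjg_commute (g h : gT) : commute g h -> g ^ h = g.
Proof. by rewrite /conjg => ->; rewrite mulKg. Qed.

(** The relations give two expressions for [y^-1], namely [x^-1 * y * x^-1] and [x * y * x]. Their
    product is [y^-1 * y^-1 = x^-1 * z * x], and the left side is [z^-1 = z]. *)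
Lemma commute_zx : commute z x.
Proof.
have yV1 : y^-1 = x^-1 * y * x^-1 by rewrite -yVx mulgK.
have yV2 : y^-1 = x * y * x by rewrite -mulgA yx mulKVg.
rewrite /commute; have -> : z * x = x * (y^-1 * y^-1).
  by rewrite {1}yV1 yV2 -!mulgA !(mulKVg, mulKg).
by rewrite -invMg -[y * y]/z inv_z.
Qed.

Lemma xJy : x ^ y = x^-1 * z.
Proof. by rewrite conjgE mulgA yVx -mulgA. Qed.

Lemma commute_zG g : g \in G -> commute z g.
Proof.
suff /subsetP sGz : G \subset 'C[z] by move/sGz/cent1P/commute_sym.
rewrite -defG join_subG !cycle_subG; apply/andP; split; apply/cent1P.
  exact/commute_sym/commute_zx.
by rewrite /commute -expgSr -expgS.
Qed.

Lemma mem_z_G : z \in G. Proof. by rewrite groupX. Qed.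
Hint Resolve mem_z_G : core.

Lemma cycle_cent_z a : a \in G -> <[a]> \subset 'C(<[z]>).
Proof.
by move=> Ga; rewrite cycle_subG /= cent_cycle; apply/cent1P/commute_sym/commute_zG.
Qed.

Lemma mem_join_z a h : a \in G -> h \in <[a]> <*> <[z]> -> exists i j, h = a ^+ i * z ^+ j.
Proof.
move=> Ga; rewrite cent_joinEl ?cycle_cent_z //.
by case/mulsgP=> _ _ /cycleP[i ->] /cycleP[j ->] ->; exists i, j.
Qed.

Lemma leq_card_join_z a : a \in G -> #|<[a]> <*> <[z]>| <= #[a] * 2.
Proof.
move=> Ga; rewrite cent_joinEl ?cycle_cent_z //.
apply: leq_trans (_ : #[a] * #[z] <= _).
  by rewrite mul_cardG leq_pmulr ?cardG_gt0.
by rewrite leq_mul2l dvdn_leq ?orbT // order_dvdn expgS expg1 mul_zz.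
Qed.

(** * The abelian normal subgroup [N] and the orders *)

Lemma mem_x_N : x \in N. Proof. by rewrite mem_gen // inE cycle_id. Qed.
Lemma mem_z_N : z \in N. Proof. by rewrite mem_gen // inE cycle_id orbT. Qed.
Hint Resolve mem_x_N mem_z_N : core.

Lemma subNG : N \subset G.
Proof. by rewrite join_subG !cycle_subG mem_x_G mem_z_G. Qed.

Lemma abelN : abelian N.
Proof.
by rewrite abelianY !cycle_abelian /= centsC cycle_cent_z.
Qed.

Lemma N_commute g h : g \in N -> h \in N -> commute g h.
Proof. by move=> Ng Nh; apply: (centsP abelN). Qed.

Lemma nNG : G \subset 'N(N).
Proof.
rewrite -defG join_subG cycle_subG (subsetP (normG N)) ?mem_x_N //= cycle_subG.
rewrite inE conjYg -!cycleJ xJy conjXg [y ^ y]conjgE mulKg join_subG !cycle_subG mem_z_N andbT.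
by rewrite groupM ?groupV.
Qed.

Lemma memNJ g t : t \in G -> (g ^ t \in N) = (g \in N).
Proof. by move=> Gt; rewrite memJ_norm // (subsetP nNG). Qed.

Lemma mem_N_or g : g \in G -> g \in N \/ y^-1 * g \in N.
Proof.
have sG : G \subset <[y]> * N.
  rewrite -norm_joinEl ?cycle_subG ?(subsetP nNG) // -{1}defG join_subG !cycle_subG.
  by rewrite !mem_gen // inE ?cycle_id ?mem_x_N ?orbT.
move/(subsetP sG)/mulsgP => [_ h /cycleP[i ->] Nh ->].
rewrite -[i]odd_double_half expgD -mul2n expgM; case: (odd i); last first.
  by left; rewrite expg0 mul1g groupM ?(groupX _ mem_z_N).
by right; rewrite expg1 -!mulgA mulKg groupM ?(groupX _ mem_z_N).
Qed.

(** The relations give the upper bounds 2n for [#[x]], 2 for [#[z]], 4n for [#|N|] and 8n for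
    [#|G|]; the lower bound [oG_ge] forces equality throughout. If [y] were in [N], then [G] would
    have only 4n elements. *)
Lemma card_V8n : [/\ #[x] = (2 * n)%N, #[z] = 2, #|N| = (4 * n)%N, #|G| = (8 * n)%N & y \notin N].
Proof.
have ox : #[x] <= 2 * n by rewrite dvdn_leq ?order_dvdn ?x2n //; lia.
have oz : #[z] <= 2 by rewrite dvdn_leq ?order_dvdn // expgS expg1 mul_zz.
have sG : G \subset N :|: y *: N.
  by apply/subsetP=> g /mem_N_or[]; rewrite inE mem_lcoset => ->; rewrite ?orbT.
have oG : #|G| <= #|N| + #|N|.
  by rewrite -{2}(card_lcoset N y) (leq_trans (subset_leq_card sG)) // cardsU leq_subr.
have oxz : (#[x] * #[z] = #|N| * #|<[x]> :&: <[z]>|)%N.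
  by rewrite cent_joinEl ?cycle_cent_z // -mul_cardG.
have leN : #|N| <= #[x] * 2 := leq_card_join_z mem_x_G.
have cap_gt0 : 0 < #|<[x]> :&: <[z]>| := cardG_gt0 _.
have [ox' oN] : #[x] = (2 * n)%N /\ #|N| = (4 * n)%N by lia.
have oz' : #[z] = 2.
  by move: oxz; rewrite ox' oN; move: cap_gt0 oz; move: #|_ :&: _| #[z] => c o; nia.
split=> //; first by lia.
apply/negP=> Ny; have : G \subset N by rewrite -defG join_subG !cycle_subG mem_x_N.
by move/subset_leq_card; nia.
Qed.

(** Comparing orders, [<[x]>] and [<[z]>] meet trivially, so [k ^+ i = z ^+ i * x ^+ (2 * i)] is 1
    only if both factors are, that is, if 2 and n both divide i. *)
Lemma order_k : #[k] = lcmn 2 n.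
Proof.
have [ox oz oN _ _] := card_V8n.
have tixz : <[x]> :&: <[z]> = 1.
  apply/eqP; rewrite trivg_card_le1.
  have : (#[x] * #[z] = #|N| * #|<[x]> :&: <[z]>|)%N.
    by rewrite cent_joinEl ?cycle_cent_z // -mul_cardG.
  by rewrite ox oz oN; move: #|_ :&: _| => c; nia.
have kX1 i : (k ^+ i == 1) = (2 %| i) && (n %| i).
  rewrite expgMn; last exact/commuteX/commute_zx.
  have -> : (n %| i) = (x ^+ 2 ^+ i == 1).
    by rewrite -expgM -order_dvdn ox dvdn_pmul2l.
  have -> : (2 %| i) = (z ^+ i == 1) by rewrite -order_dvdn oz.
  apply/eqP/andP => [zx1 | [/eqP-> /eqP->]]; last by rewrite mulg1.
  have zi1 : z ^+ i = 1.
    apply/set1gP; rewrite -tixz inE mem_cycle andbT.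
    by rewrite -[_ ^+ i](mulgK (x ^+ 2 ^+ i)) zx1 mul1g groupV !groupX ?cycle_id.
  by move: zx1; rewrite zi1 mul1g => ->.
apply/eqP; rewrite eqn_dvd order_dvdn kX1 dvdn_lcml dvdn_lcmr /= dvdn_lcm -kX1.
by rewrite expg_order.
Qed.

(** * Conjugation outside [N], and the centre *)

Lemma mem_N_mulV g h : g \in G -> g \notin N -> h \in G -> h \notin N -> g^-1 * h \in N.
Proof.
move=> /mem_N_or[-> // | Ng] _ /mem_N_or[-> // | Nh] _.
by rewrite -[h](mulKVg y) -[g](mulKVg y) invMg -!mulgA mulKg groupM ?groupV.
Qed.

Lemma mem_y_mulN h : h \in N -> y * h \notin N.
Proof. by move=> Nh; rewrite groupMr //; case: card_V8n. Qed.

(** Since [g] lies in [y *: N] and [N] is abelian, [g] acts on [N] as [y] does. *)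
Lemma xJ_notN g : g \in G -> g \notin N -> x ^ g = x^-1 * z.
Proof.
move=> /mem_N_or[-> // | Ng] _; rewrite -[g](mulKVg y) conjgM xJy.
by apply/conjg_commute/N_commute => //; rewrite groupM ?groupV.
Qed.

Lemma mem_k_N : k \in N. Proof. by rewrite groupM // groupX. Qed.
Lemma mem_k_G : k \in G. Proof. by rewrite groupM // groupX. Qed.
Hint Resolve mem_k_N mem_k_G : core.

Lemma conj_xX g i : g \in G -> g \notin N -> g ^ (x ^+ i) = g * k ^+ i.
Proof.
move=> Gg nNg; have xJg := xJ_notN Gg nNg.
(* Indeed [x^-1 * g * x = g * (x ^ g)^-1 * x], and [(x ^ g)^-1 = z * x]. As [k] commutes with [x],
   this iterates. *)
have gx : g ^ x = g * k.
  rewrite conjgE mulgA -[x^-1 * g](mulKVg g) -[g^-1 * _]conjgE conjVg xJg.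
  by rewrite invMg invgK inv_z -!mulgA.
elim: i => [|i IHi]; first by rewrite conjg1 mulg1.
rewrite expgSr conjgM IHi conjMg gx (conjg_commute (N_commute _ _)) ?groupX //.
by rewrite -mulgA -expgS.
Qed.

Lemma class_notN g : g \in G -> g \notin N -> g ^: G = g *: <[k]>.
Proof.
move=> Gg nNg.
have gJN h : h \in N -> g ^ h \in g *: <[k]>.
  move=> /(mem_join_z mem_x_G)[i [j ->]]; rewrite conjgM conj_xX // mem_lcoset.
  by rewrite conjg_commute ?mulKg ?mem_cycle //; apply/commuteX/commute_sym/commute_zG;
     rewrite groupM ?(groupX _ mem_k_G).
apply/eqP; rewrite eqEsubset; apply/andP; split; apply/subsetP=> h.
  case/imsetP=> t Gt ->; have [/gJN // | nNt] := boolP (t \in N).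
  (* As [g] commutes with itself, the conjugator [t] may be replaced by [g^-1 * t], which is in
     [N]. *)
  rewrite -[t](mulKVg g) conjgM [g ^ g]conjgE mulKg; apply: gJN.
  exact: mem_N_mulV.
rewrite mem_lcoset => /cycleP[i gh].
by apply/imsetP; exists (x ^+ i); rewrite ?groupX // conj_xX // -gh mulKVg.
Qed.

Lemma card_class_notN g : g \in G -> g \notin N -> #|g ^: G| = lcmn 2 n.
Proof. by move=> Gg nNg; rewrite class_notN // card_lcoset -order_k. Qed.

(** [N] and [g] together generate [G], and [h] commutes with [g] and with all of the abelian group
    [N]. *)
Lemma mem_center_commute g h : g \in G -> g \notin N -> h \in N -> commute g h -> h \in Z.
Proof.
move=> Gg nNg Nh gh; rewrite inE (subsetP subNG) //=.
apply/centP=> t Gt; have [Nt | nNt] := boolP (t \in N); first exact: N_commute.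
rewrite -[t](mulKVg g); apply: commuteM; first exact: commute_sym.
by apply: N_commute => //; apply: mem_N_mulV.
Qed.

Lemma order_k_gt1 : 1 < #[k].
Proof. by rewrite order_k (leq_trans _ (dvdn_leq _ (dvdn_lcml 2 n))) // lcmn_gt0. Qed.

(** A central [t] outside [N] would satisfy [t = t ^ x = t * k], although [k] is not 1. *)
Lemma sub_center_N : Z \subset N.
Proof.
apply/subsetP=> t /setIP[Gt /centP ct]; apply: contraLR order_k_gt1 => nNt.
have := conj_xX 1 Gt nNt; rewrite !expg1 (conjg_commute (ct x mem_x_G)) => /esym/eqP.
by rewrite -{2}[t]mulg1 (inj_eq (mulgI t)) => /eqP->; rewrite order1.
Qed.

(** Orbit-stabilizer for [y]: its class has [lcmn 2 n] elements, and its centralizer, the disjoint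
    union of [Z] and [y *: Z], has [2 * #|Z|]. *)
Lemma card_center : (lcmn 2 n * #|Z| = 4 * n)%N.
Proof.
have [_ _ oN oG nNy] := card_V8n.
have Cy : 'C_G[y] = Z :|: y *: Z.
  apply/setP=> t; rewrite in_setI in_setU mem_lcoset; apply/andP/orP => [[Gt /cent1P ty] | ].
    have [Nt | nNt] := boolP (t \in N).
      by left; apply: (mem_center_commute mem_y_G nNy Nt); apply: commute_sym.
    right; apply: (mem_center_commute mem_y_G nNy); first exact: mem_N_mulV.
    by apply: commuteM; [apply: commuteV | exact: commute_sym].
  case=> [/setIP[Gt /centP ct] | /setIP[Gyt /centP ct]].
    by split=> //; apply/cent1P; apply: ct.
  rewrite -[t](mulKVg y) groupM //; split=> //; apply/cent1P/commute_sym.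
  by apply: commuteM => //; apply/commute_sym/ct.
have : #|'C_G[y]| = (2 * #|Z|)%N.
  rewrite Cy cardsU card_lcoset disjoint_setI0 ?cards0; first by rewrite subn0 addnn mul2n.
  rewrite disjoint_subset; apply/subsetP=> t Zt; rewrite inE mem_lcoset.
  apply: contra nNy => /(subsetP sub_center_N); rewrite groupMr ?groupV //.
  exact: (subsetP sub_center_N).
have := Lagrange (subcent1_sub y G); rewrite index_cent1 card_class_notN // oG.
by move=> + oC; rewrite oC; lia.
Qed.

(** The centralizer of [h] is exactly [N]: an element outside [N] commuting with [h] would make [h]
    central. *)
Lemma card_class_N h : h \in N -> h \notin Z -> #|h ^: G| = 2.
Proof.
move=> Nh nZh; have [_ _ oN oG _] := card_V8n.
have Gh := subsetP subNG _ Nh.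
have -> : #|h ^: G| = #|G : N|.
  rewrite -index_cent1; congr #|_ : _|; apply/setP=> t; rewrite inE.
  apply/andP/idP => [[Gt /cent1P th] | Nt]; last first.
    by split; [exact: (subsetP subNG) | apply/cent1P/N_commute].
  by apply: contraR nZh => nNt; apply: mem_center_commute nNt Nh _.
by rewrite -divgS ?subNG // oN oG; nia.
Qed.

(** * The subgroup [M] and the colouring *)

Lemma mem_z_M : z \in M. Proof. by rewrite mem_gen // inE cycle_id orbT. Qed.
Lemma mem_x2_M : x ^+ 2 \in M. Proof. by rewrite mem_gen // inE cycle_id. Qed.
Hint Resolve mem_z_M mem_x2_M : core.
Lemma mem_k_M : k \in M. Proof. by rewrite groupM. Qed.

Lemma subMN : M \subset N.
Proof. by rewrite join_subG !cycle_subG mem_z_N groupX. Qed.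

Lemma mem_M_or h : h \in N -> h \in M \/ x^-1 * h \in M.
Proof.
case/(mem_join_z mem_x_G)=> i [j ->]; rewrite -[i]odd_double_half expgD -mul2n expgM.
case: (odd i); [right | left].
  by rewrite expg1 -!mulgA mulKg groupM ?(groupX _ mem_z_M) ?(groupX _ mem_x2_M).
by rewrite expg0 mul1g groupM ?(groupX _ mem_z_M) ?(groupX _ mem_x2_M).
Qed.

(** [N] is covered by [M] and [x *: M], so two elements of [N] outside [M] share a coset. *)
Lemma mem_M_mulV a b : a \in N -> b \in N -> (a^-1 * b \in M) = ((a \in M) == (b \in M)).
Proof.
move=> Na Nb; have [Ma | nMa] := boolP (a \in M); first by rewrite groupMl ?groupV.
have [Mb | nMb] := boolP (b \in M); first by rewrite groupMr ?groupV // (negPf nMa).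
have [/(negP nMa) [] // | Ma] := mem_M_or Na.
have [/(negP nMb) [] // | Mb] := mem_M_or Nb.
by rewrite -[a](mulKVg x) -[b](mulKVg x) invMg -!mulgA mulKg groupM ?groupV.
Qed.

Lemma card_M : #|M| = (2 * n)%N.
Proof.
have [ox _ oN _ _] := card_V8n.
have leM : #|M| <= #[x ^+ 2] * 2 by apply: leq_card_join_z; rewrite groupX.
have ox2 : #[x ^+ 2] <= n by rewrite dvdn_leq // order_dvdn -expgM x2n.
have leN : #|N| <= #|M| + #|M|.
  have sN : N \subset M :|: x *: M.
    by apply/subsetP=> g /mem_M_or[]; rewrite inE mem_lcoset => ->; rewrite ?orbT.
  by rewrite -{2}(card_lcoset M x) (leq_trans (subset_leq_card sN)) // cardsU leq_subr.
by lia.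
Qed.

Lemma mem_M_k h : h \in M -> exists i j, h = k ^+ i * z ^+ j.
Proof.
(* As [z] squares to 1, [x ^+ 2 ^+ i = k ^+ i * z ^+ i]; hence the exponent [i + j]. *)
case/(mem_join_z (groupX 2 mem_x_G))=> i [j ->]; exists i, (i + j)%N.
have zzi : z ^+ i * z ^+ i = 1 by rewrite -expgMn // mul_zz expg1n.
have zxi : commute (z ^+ i) (x ^+ 2 ^+ i) by apply/commuteX2/commuteX/commute_zx.
rewrite [k ^+ i]expgMn; last exact/commuteX/commute_zx.
by rewrite zxi expgD -mulgA (mulgA (z ^+ i)) zzi mul1g.
Qed.

(** If [t = x ^+ i * z ^+ j] is central, then [y = y ^ t = y * k ^+ i], so the even number [#[k]]
    divides i and [x ^+ i] is a power of [x ^+ 2]. *)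
Lemma sub_center_M : Z \subset M.
Proof.
apply/subsetP=> t Zt; have Nt := subsetP sub_center_N _ Zt.
have [_ _ _ _ nNy] := card_V8n.
case/(mem_join_z mem_x_G): Nt => i [j tE]; rewrite tE groupM ?(groupX _ mem_z_M) //.
have : y ^ t = y * k ^+ i.
  rewrite tE conjgM conj_xX // conjg_commute //; apply/commuteX/commute_sym/commute_zG.
  by rewrite groupM ?(groupX _ mem_k_G).
case/setIP: Zt => Gt /centP ct; rewrite (conjg_commute (commute_sym (ct y mem_y_G))) => yk.
have /eqP : k ^+ i = 1 by apply: (mulgI y); rewrite -yk mulg1.
rewrite -order_dvdn order_k => /(dvdn_trans (dvdn_lcml 2 n)).
by case/dvdnP=> q ->; rewrite mulnC expgM groupX.
Qed.

(* The partition of [G] into [N], [yM] and [yxM]. *)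
Definition colour (g : gT) : 'I_3 :=
  if g \in N then Ordinal (isT : 0 < 3) else
  if y^-1 * g \in M then Ordinal (isT : 1 < 3) else Ordinal (isT : 2 < 3).

Lemma colour_eq g h : g \in G -> g \notin N -> h \in G -> h \notin N ->
  (colour g == colour h) = (g^-1 * h \in M).
Proof.
move=> Gg nNg Gh nNh; have [_ _ _ _ nNy] := card_V8n.
have -> : g^-1 * h = (y^-1 * g)^-1 * (y^-1 * h) by rewrite invMg -!mulgA mulKg.
rewrite mem_M_mulV ?mem_N_mulV // /colour (negPf nNg) (negPf nNh).
by case: (_ \in M); case: (_ \in M).
Qed.

Lemma colour_N g h : g \in N -> h \notin N -> (colour g == colour h) = false.
Proof. by move=> Ng nNh; rewrite /colour Ng (negPf nNh); case: ifP. Qed.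

Lemma sub_k_M : <[k]> \subset M. Proof. by rewrite cycle_subG mem_k_M. Qed.

Lemma colourJ g t : g \in G -> t \in G -> colour (g ^ t) = colour g.
Proof.
move=> Gg Gt; have [Ng | nNg] := boolP (g \in N).
  by rewrite /colour memNJ // Ng.
apply/esym/eqP; rewrite colour_eq ?memNJ ?groupJ //.
have : g ^ t \in g *: <[k]> by rewrite -class_notN // memJ_class.
by rewrite mem_lcoset => /(subsetP sub_k_M).
Qed.

Lemma commuting_classes g h : g \in G :\: Z -> h \in G :\: Z ->
  [exists a in g ^: G, exists b in h ^: G, a * b == b * a] = (colour g == colour h).
Proof.
(* This excludes edges between [N] and its complement. *)
have noncomm a b : a \in N -> a \notin Z -> b \in G -> b \notin N -> a * b != b * a.
  by move=> Na nZa Gb nNb; apply: contra nZa => /eqP ab; apply: (mem_center_commute Gb nNb).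
have nZJ a t : t \in G -> (a ^ t \in Z) = (a \in Z).
  by move=> Gt; rewrite memJ_norm // (subsetP (gFnorm _ _)).
case/setDP=> Gg nZg /setDP[Gh nZh].
have [Ng | nNg] := boolP (g \in N); have [Nh | nNh] := boolP (h \in N).
- rewrite /colour Ng Nh eqxx; apply/exists_inP; exists g; first exact: class_refl.
  by apply/exists_inP; exists h; [exact: class_refl | apply/eqP/N_commute].
- rewrite colour_N //; apply/exists_inP => -[_ /imsetP[s Gs ->] /exists_inP[_ /imsetP[t Gt ->]]].
  by apply/negP/noncomm; rewrite ?memNJ ?nZJ ?groupJ.
- rewrite eq_sym colour_N //.
  apply/exists_inP => -[_ /imsetP[s Gs ->] /exists_inP[_ /imsetP[t Gt ->]]].
  by apply/negP; rewrite eq_sym; apply: noncomm; rewrite ?memNJ ?nZJ ?groupJ.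
rewrite colour_eq //; apply/exists_inP/idP.
  case=> a aP /exists_inP[b bP /eqP ab].
  have [Ga nNa] : a \in G /\ a \notin N.
    by case/imsetP: aP => t Gt ->; rewrite memNJ // groupJ.
  have [Gb nNb] : b \in G /\ b \notin N.
    by case/imsetP: bP => t Gt ->; rewrite memNJ // groupJ.
  (* [a^-1 * b] lies in [N] and commutes with [a], so it is central. *)
  have Mab : a^-1 * b \in M.
    apply: (subsetP sub_center_M); apply: (mem_center_commute Ga nNa); first exact: mem_N_mulV.
    by apply: commuteM => //; apply: commuteV.
  rewrite -colour_eq //; move: Mab; rewrite -colour_eq //.
  case/imsetP: aP => s Gs ->; case/imsetP: bP => t Gt ->.
  by rewrite !colourJ.
(* With [g^-1 * h = k ^+ i * z ^+ j], this conjugate of [g] differs from [h] only by the central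
   factor [z ^+ j]. *)
case/mem_M_k=> i [j ghE]; exists (g * k ^+ i).
  by rewrite class_notN // mem_lcoset mulKg mem_cycle.
apply/exists_inP; exists h; first exact: class_refl.
apply/eqP; rewrite -/(commute _ _) -[h](mulKVg g) ghE (mulgA g).
apply: commuteM => //; apply/commuteX/commute_sym/commute_zG.
by rewrite groupM ?(groupX _ mem_k_G).
Qed.

(** * Counting the vertices of each colour *)

Local Notation rep := (fun u : CCC G => repr (val u)).

Lemma rep_class (u : CCC G) : rep u \in G :\: Z /\ val u = rep u ^: G.
Proof.
case: u => C /= /imsetP[g /setDP[Gg nZg] ->].
have /imsetP[t Gt ->] : repr (g ^: G) \in g ^: G by apply: (mem_repr g) (class_refl _ _).
by rewrite inE memJ_norm ?(subsetP (gFnorm _ _)) // nZg groupJ // classGidl.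
Qed.

Lemma edge_colour (u v : CCC G) :
  edge u v = (u != v) && (colour (rep u) == colour (rep v)).
Proof.
have [[Zu uE] [Zv vE]] := (rep_class u, rep_class v).
by rewrite -commuting_classes // -uE -vE.
Qed.

(** The noncentral elements of colour [j] are stable under conjugation, and their orbits are the
    vertices of that colour; all orbits have size [q]. *)
Lemma card_colour j q :
    {in G :\: Z, forall g, colour g = j -> #|g ^: G| = q} ->
  (#|[set u : CCC G | colour (rep u) == j]| * q = #|[set g in G :\: Z | colour g == j]|)%N.
Proof.
move=> card_q; set S := [set g in _ | _].
have actS : [acts G, on S | 'J].
  apply/actsP=> t Gt g; rewrite /S [in LHS]in_set [in RHS]in_set !in_setD /=.
  rewrite memJ_norm ?(subsetP (gFnorm _ _)) // groupJr //.
  by case: (boolP (g \in G)) => [Gg | _]; rewrite ?andbF // colourJ.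
rewrite -(card_imset _ val_inj).
have -> : [set val u | u in [set u : CCC G | colour (rep u) == j]] = orbit 'J G @: S.
  apply/setP=> C; apply/imsetP/imsetP => [[u] | [g]].
    rewrite inE => cu ->; have [Zu uE] := rep_class u.
    by exists (rep u); rewrite // /S in_set Zu.
  rewrite in_set => /andP[Zg cg] ->.
  have Cg : g ^: G \in noncentral_classes G by apply: imset_f.
  exists (Sub (g ^: G) Cg) => //; rewrite inE /=.
  have /imsetP[t Gt ->] : repr (g ^: G) \in g ^: G by apply: (mem_repr g) (class_refl _ _).
  by rewrite colourJ //; case/setDP: Zg.
apply/esym/card_uniform_partition; last exact: orbit_partition.
by move=> _ /imsetP[g + ->]; rewrite in_set => /andP[Zg /eqP cg]; apply: card_q.
Qed.

(** Elements are divided by class sizes. With w = gcd(2, n), the centre has 2w elements, so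
    [N :\: Z] has 4n - 2w, in classes of size 2; each other colour has 2n elements, in classes of
    size lcm(2, n) = 2n/w. *)
Lemma card_colours (j : 'I_3) :
  #|[set u : CCC G | colour (rep u) == j]| =
    nth 0 [:: (2 * n - gcdn 2 n)%N; gcdn 2 n; gcdn 2 n] j.
Proof.
have [_ _ oN oG nNy] := card_V8n.
have lg : (lcmn 2 n * gcdn 2 n = 2 * n)%N by rewrite muln_lcm_gcd.
have l_gt0 : 0 < lcmn 2 n by rewrite lcmn_gt0.
have oZ : #|Z| = (2 * gcdn 2 n)%N.
  by apply/eqP; rewrite -(eqn_pmul2l l_gt0) card_center mulnCA lg; lia.
have yMG : y *: M \subset G :\: N.
  apply/subsetP=> g; rewrite mem_lcoset => Mg; have Ng := subsetP subMN _ Mg.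
  by rewrite -[g](mulKVg y) inE mem_y_mulN // groupM // (subsetP subNG).
have notN_class (c : 'I_3) : c != 0 :> nat ->
    (#|[set u : CCC G | colour (rep u) == c]| * lcmn 2 n =
     #|[set g in G :\: N | colour g == c]|)%N.
  move=> nc; rewrite (card_colour (q := lcmn 2 n)).
    apply: eq_card => g; rewrite [in LHS]in_set [in RHS]in_set !in_setD.
    have [Ng | nNg] := boolP (g \in N); last first.
      by rewrite (contra (subsetP sub_center_N g)).
    by rewrite /colour Ng; case: c nc => [[]] //= ? ?; rewrite andbF.
  move=> g /setDP[Gg _] cg; apply: card_class_notN => //; apply/negP => Ng.
  by move: nc; rewrite -cg /colour Ng.
have colourE g : g \in G -> g \notin N -> colour g = (y^-1 * g \notin M).+1 :> nat.
  by move=> _ nNg; rewrite /colour (negPf nNg); case: ifP.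
case: j => [[|[|[|j]]] lt_j3] //=.
- apply/eqP; rewrite -(eqn_pmul2r (isT : 0 < 2)) card_colour => [|g /setDP[Gg nZg] cg].
    have -> : [set g in G :\: Z | colour g == Ordinal lt_j3] = N :\: Z.
      apply/setP=> g; rewrite in_set !in_setD /colour.
      have [Ng | nNg] := boolP (g \in N); first by rewrite (subsetP subNG) // -val_eqE !andbT.
      by case: ifP; rewrite !andbF.
    by rewrite cardsD (setIidPr sub_center_N) oN oZ; lia.
  apply: card_class_N nZg; apply/idPn => nNg.
  by have := colourE g Gg nNg; rewrite cg.
- apply/eqP; rewrite -(eqn_pmul2r l_gt0) notN_class // [in eqbRHS]mulnC lg -card_M.
  rewrite -(card_lcoset M y); apply/eqP/eq_card => g; rewrite in_set -val_eqE.
  apply/andP/idP => [[/setDP[Gg nNg]] | yMg].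
    by rewrite /= colourE // mem_lcoset; case: (_ \in M).
  have GNg := subsetP yMG _ yMg; split=> //; case/setDP: GNg => Gg nNg.
  by rewrite /= colourE // -mem_lcoset yMg.
apply/eqP; rewrite -(eqn_pmul2r l_gt0) notN_class // [in eqbRHS]mulnC lg.
(* Counted as a complement: 4n - 2n elements. *)
have -> : [set g in G :\: N | colour g == Ordinal lt_j3] = (G :\: N) :\: (y *: M).
  apply/setP=> g; rewrite [in LHS]in_set [in RHS]in_setD [in RHS]andbC -val_eqE.
  case: (boolP (g \in G :\: N)) => //= /setDP[Gg nNg].
  by rewrite colourE // mem_lcoset; case: (_ \in M).
rewrite cardsD (setIidPr yMG) card_lcoset card_M cardsD (setIidPr subNG) oN oG.
by lia.
Qed.

End Structure.

Lemma V8n_CCC_cluster n (gT : finGroupType) (G : {group gT}) :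
  (0 < n)%N ->
  (G \isog Grp (x : y : x ^+ (2 * n), y ^+ 4,
                        y * x = x^-1 * y^-1, y^-1 * x = x^-1 * y))%g ->
  exists c : CCC G -> 'I_3,
    (forall u v, edge u v = (u != v) && (c u == c v)) /\
    forall j, #|[set u | c u == j]| =
      nth 0%N [:: (2 * n - gcdn 2 n)%N; gcdn 2 n; gcdn 2 n] j.
Proof.
move=> n_gt0 isoG.
(* The model satisfies the relations, hence is a homomorphic image of [G]. *)
have oG : (8 * n <= #|G|)%N.
  apply: leq_trans (leq_card_model n_gt0) _; apply: leq_homg.
  by rewrite isoG model_homGrp.
have /existsP[[x y]] := isoGrp_hom isoG.
rewrite /= !xpair_eqE => /and5P[/eqP defG /eqP x2n /eqP y4 /eqP yx /eqP yVx].
exists (fun u => colour x y (repr (val u))); split.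
  exact: (edge_colour n_gt0 defG x2n y4 yx yVx oG).
exact: (card_colours n_gt0 defG x2n y4 yx yVx oG).
Qed.

(** * Comparison of the energies *)

Section Comparison.
Local Open Scope ring_scope.

(** The bounds on [d] fix the sign inside every absolute value. The Laplacian total then exceeds the
    signless one by 2d in both cases, and the signless total exceeds the energy by (a - 1)(a - 2 -
    d) + d if b = 1, and by (a - 1)(a - 2 - d) + 3d - 8 if b = 2. *)
Lemma clique_energies_lt (a b d : rat) :
  (b = 1 /\ 5 <= a) \/ (b = 2 /\ 6 <= a) ->
  d = (a * (a - 1) + 2 * (b * (b - 1))) / (a + 2 * b) ->
  clique_energy a + 2 * clique_energy b <
    clique_signless_energy d a + 2 * clique_signless_energy d b <
    clique_laplacian_energy d a + 2 * clique_laplacian_energy d b.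
Proof.
move=> ab dE; have ab_gt0 : 0 < a + 2 * b by lra.
have dM : d * (a + 2 * b) = a * (a - 1) + 2 * (b * (b - 1)).
  by rewrite dE divfK ?gt_eqF.
have d_le : d <= a - 2 by rewrite dE ler_pdivrMr //; nra.
rewrite /clique_energy /clique_signless_energy /clique_laplacian_energy.
case: ab => -[bE a_ge]; subst b.
  have d_ge1 : 1 <= d by rewrite dE ler_pdivlMr //; nra.
  rewrite [`|1 - 2 - d|]ler0_norm ?[`|1 - d|]ler0_norm ?[`|2 * 1 - 2 - d|]ler0_norm; try lra.
  by rewrite !ger0_norm; try lra; apply/andP; split; nra.
have d_ge2 : 2 <= d by rewrite dE ler_pdivlMr //; nra.
rewrite [`|2 - d|]ler0_norm ?[`|2 - 2 - d|]ler0_norm; try lra.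
by rewrite !ger0_norm; try lra; apply/andP; split; nra.
Qed.

Lemma sum_cluster_sizes (s : 'I_3 -> nat) (a b : nat) (F : rat -> rat) :
  (forall j, s j = nth 0%N [:: a; b; b] j) ->
  \sum_j F (s j)%:R = F a%:R + 2 * F b%:R.
Proof. by move=> sE; rewrite !big_ord_recl big_ord0 !sE /=; ring. Qed.

Section ThreeCliques.
Variables (Gr : sgraph) (c : Gr -> 'I_3) (a b : nat).
Hypothesis edge_cluster : forall u v, edge u v = (u != v) && (c u == c v).
Hypothesis cluster_sizes :
  forall j, #|[set u | c u == j]| = nth 0%N [:: a; b; b] j.

Let energies (d := cluster_avg_degree c) :
  [/\ d = (a%:R * (a%:R - 1) + 2 * (b%:R * (b%:R - 1))) / (a%:R + 2 * b%:R),
      energy Gr = ratr (clique_energy a%:R + 2 * clique_energy b%:R),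
      signless_laplacian_energy Gr =
        ratr (clique_signless_energy d a%:R + 2 * clique_signless_energy d b%:R)
    & laplacian_energy Gr =
        ratr (clique_laplacian_energy d a%:R + 2 * clique_laplacian_energy d b%:R)].
Proof.
rewrite (energy_cluster edge_cluster) (signless_laplacian_energy_cluster edge_cluster).
rewrite (laplacian_energy_cluster edge_cluster) !(sum_cluster_sizes _ cluster_sizes).
split=> //; rewrite /d /cluster_avg_degree.
rewrite (sum_cluster_sizes (fun t => t * (t - 1)) cluster_sizes).
by rewrite (sum_cluster_sizes id cluster_sizes).
Qed.

Lemma three_cliques_energies_lt :
  (b = 1 /\ 5 <= a)%N \/ (b = 2 /\ 6 <= a)%N ->
  energy Gr < signless_laplacian_energy Gr < laplacian_energy Gr.
Proof.
have [dE -> -> ->] := energies; rewrite !ltr_rat => ab.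
apply: clique_energies_lt dE.
by case: ab => -[-> a_ge]; [left | right]; split=> //; rewrite ler_nat.
Qed.

(** Three disjoint edges form a 1-regular graph: d = 1, and all three energies evaluate to 6. *)
Lemma three_edges_energies_eq : a = 2 -> b = 2 ->
  energy Gr = signless_laplacian_energy Gr /\
  signless_laplacian_energy Gr = laplacian_energy Gr.
Proof.
have [dE -> -> ->] := energies => a2 b2.
by have -> : cluster_avg_degree c = 1; [rewrite dE | ]; rewrite a2 b2.
Qed.

End ThreeCliques.

(** Odd n is at least 3, so a = 2n - 1 is at least 5; even n other than 2 is at least 4, so a = 2n -
    2 is at least 6. *)
Lemma V8n_clique_sizes n (b := gcdn 2 n) (a := (2 * n - b)%N) :
  (2 <= n)%N -> n <> 2 -> (b = 1 /\ 5 <= a)%N \/ (b = 2 /\ 6 <= a)%N.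
Proof.
rewrite /a /b => n_ge2 n_neq2; have [odd_n | even_n] := boolP (odd n); [left | right].
  have -> : gcdn 2 n = 1%N by apply/eqP; rewrite -/(coprime 2 n) coprime2n.
  by split=> //; lia.
have -> : gcdn 2 n = 2%N by apply/gcdn_idPl; rewrite dvdn2.
by split=> //; lia.
Qed.

(** Reduces the four claims to equality when [P] holds and strict inequality otherwise; [P] will be
    [n = 2]. *)
Lemma le_eq_iff_of_lt_eq (disp : Order.disp_t) (T : porderType disp) (P : Prop) (u v w : T) :
  P \/ ~ P -> (P -> u = v /\ v = w) -> (~ P -> (u < v < w)%O) ->
  [/\ (u <= v)%O, (v <= w)%O, u = v <-> P & v = w <-> P].
Proof.
move=> decP eq_uvw lt_uvw; case: decP => p; first by have [-> ->] := eq_uvw p.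
have /andP[lt_uv lt_vw] := lt_uvw p.
split; [exact: ltW | exact: ltW | |]; split=> // eq_.
- by rewrite eq_ ltxx in lt_uv.
- by rewrite eq_ ltxx in lt_vw.
Qed.

End Comparison.

Theorem theorem4p4 (n : nat) (gT : finGroupType) (G : {group gT}) :
  (2 <= n)%N ->
  (G \isog Grp (x : y : x ^+ (2 * n), y ^+ 4,
                        y * x = x^-1 * y^-1, y^-1 * x = x^-1 * y))%g ->
  [/\ (energy (CCC G) <= signless_laplacian_energy (CCC G))%R,
      (signless_laplacian_energy (CCC G) <= laplacian_energy (CCC G))%R,
      energy (CCC G) = signless_laplacian_energy (CCC G) <-> n = 2%N
    & signless_laplacian_energy (CCC G) = laplacian_energy (CCC G) <-> n = 2%N].
Proof.
move=> n_ge2 isoG; have [c [edge_c size_c]] := V8n_CCC_cluster (ltnW n_ge2) isoG.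
apply: le_eq_iff_of_lt_eq => [|n2|n_neq2].
- by case: (n =P 2%N); [left | right].
- by apply: (three_edges_energies_eq edge_c size_c); rewrite n2.
- exact: three_cliques_energies_lt edge_c size_c (V8n_clique_sizes n_ge2 n_neq2).
Qed.
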